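(* Let $s\geq 3$ be an odd integer and let $m$ be a positive integer such that $4^m\equiv 1 \pmod{s}$ and $2^m\geq s$. Then for every positive integer $k$, $$M_s\bigl(2^{2mk}-2^{mk}-1\bigr)=\frac{2^{2mk}-1}{s}+1.$$
   Context: For integers $c,s\geq 1$, $K_{c\times s}$ denotes the complete multipartite graph with $c$ classes of $s$ vertices each. For a subgraph $H$ of $K_{c\times s}$, $\overline{H}$ denotes the complement of $H$ relative to $K_{c\times s}$. $C_4$ is the $4$-cycle and $K_{1,n}$ is the star with $n+1$ vertices. $M_s(n)$ is the smallest positive integer $c$ such that for every subgraph $H$ of $K_{c\times s}$, $H$ contains a copy of $C_4$ or $\overline{H}$ contains a copy of $K_{1,n}$. *)

(* Defs.v *)
From mathcomp Require Import all_boot.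

Set Implicit Arguments.
Unset Strict Implicit.
Unset Printing Implicit Defensive.

(* Graphs are symmetric irreflexive relations on a finite vertex type.
   A copy need not be induced. *)
Definition contains_copy (T V : finType) (F : rel T) (G : rel V) : Prop :=
  exists f : T -> V, injective f /\ forall x y, F x y -> G (f x) (f y).

Definition C4 : rel 'I_4 := fun x y => (y == ordS x) || (x == ordS y).

(* The centre of the star is ord0. *)
Definition star (n : nat) : rel 'I_n.+1 :=
  fun x y => (x == ord0) (+) (y == ord0).

(* The vertex (i, j) is the j-th vertex of the i-th class. *)
Definition Kmulti (c s : nat) : rel ('I_c * 'I_s) := fun u v => u.1 != v.1.

(* Subgraphs are spanning; irreflexivity of H follows from inclusion in G. *)
Definition is_subgraph (V : finType) (H G : rel V) : Prop :=
  symmetric H /\ subrel H G.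

Definition rel_compl (V : finType) (G H : rel V) : rel V :=
  fun u v => G u v && ~~ H u v.

Definition arrows_C4_star (c s n : nat) : Prop :=
  forall H : rel ('I_c * 'I_s), is_subgraph H (@Kmulti c s) ->
    contains_copy C4 H \/
    contains_copy (@star n) (rel_compl (@Kmulti c s) H).

(* [is_M s n c] reads "M_s(n) = c"; it includes the existence of the minimum. *)
Definition is_M (s n c : nat) : Prop :=
  [/\ 0 < c, arrows_C4_star c s n &
      forall c', 0 < c' -> arrows_C4_star c' s n -> c <= c'].

(* Main.v *)
Require Import Defs.
From mathcomp Require Import all_boot.
From mathcomp Require Import all_algebra all_field.
From mathcomp Require Import zify ring.

(** Put [q = 2 ^ (m * k)], so that [s] divides [q ^ 2 - 1] and [s <= q].

    Upper bound: if no vertex has [n = q ^ 2 - q - 1] non-neighbours in other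
    classes, then [H] has minimum degree at least [q + 1]; a [C_4]-free graph
    with that property has more than [q * (q + 1)] vertices, as the
    second neighbourhoods through distinct neighbours of a vertex are disjoint.
    But there are only [q ^ 2 - 1 + s] vertices.

    Lower bound: on the [q ^ 2 - 1] nonzero vectors of the plane over [F_q],
    join [u] and [v] when [det (u, v) = 1]. In characteristic 2 this is
    symmetric; it is [C_4]-free and [q]-regular, so each vertex has only
    [q ^ 2 - q - 2] non-neighbours other than itself. Deleting the edges inside
    the classes of any partition keeps both properties relative to the complete
    multipartite graph. *)

Lemma contains_C4 (V : finType) (H : rel V) (a b c d : V) :
    symmetric H -> irreflexive H -> a != c -> b != d ->
    H a b -> H b c -> H c d -> H d a ->
  contains_copy C4 H.
Proof.
move=> symH irrH ac bd Hab Hbc Hcd Hda.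
have neq x y : H x y -> x != y by apply: contraTneq => ->; rewrite irrH.
have uniq4 : uniq [:: a; b; c; d].
  rewrite /= !inE !negb_or (neq _ _ Hab) ac bd (neq _ _ Hbc) (neq _ _ Hcd).
  by rewrite eq_sym (neq _ _ Hda).
exists (fun i : 'I_4 => nth a [:: a; b; c; d] i); split.
  by move=> i j /eqP; rewrite nth_uniq ?ltn_ord // => /eqP/val_inj.
have step (x : 'I_4) :
    H (nth a [:: a; b; c; d] x) (nth a [:: a; b; c; d] (ordS x)).
  by case: x => [[|[|[|[|]]]] ?].
by move=> x y /orP[] /eqP->; rewrite // symH.
Qed.

Lemma C4_copy_vertices (V : finType) (H : rel V) : contains_copy C4 H ->
  exists a b c d, [/\ a != c, b != d & [&& H a b, H b c, H c d & H d a]].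
Proof.
case=> f [f_inj f_edge].
pose o i (lti : i < 4) := Ordinal lti.
exists (f (o 0 isT)), (f (o 1 isT)), (f (o 2 isT)), (f (o 3 isT)).
split; rewrite ?(inj_eq f_inj) //.
by apply/and4P; split; apply: f_edge.
Qed.

Lemma contains_starP (V : finType) (n : nat) (G : rel V) :
    symmetric G -> irreflexive G ->
  contains_copy (@star n) G <-> exists v, n <= #|[set w | G v w]|.
Proof.
move=> symG irrG; split=> [[f [f_inj f_edge]]|[v le_n]].
  exists (f ord0).
  have fl_inj : injective (fun i : 'I_n => f (lift ord0 i)).
    by move=> i j /f_inj/lift_inj.
  rewrite -[X in X <= _]card_ord -cardsT -(card_imset _ fl_inj).
  apply/subset_leq_card/subsetP=> _ /imsetP[i _ ->].
  by rewrite inE f_edge // /star eqxx eq_sym (negbTE (neq_lift _ _)).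
pose g (i : 'I_n) := enum_val (widen_ord le_n i).
have Gg i : G v (g i) by have := enum_valP (widen_ord le_n i); rewrite inE.
(* The default of [oapp] sends the centre to [v]; irreflexivity of [G] keeps [v] off the leaves. *)
exists (fun i => oapp g v (unlift ord0 i)); split.
  move=> i j; case: unliftP => [i'|] ->; case: unliftP => [j'|] -> //=.
  - by move/enum_val_inj/(congr1 val) => /= /val_inj->.
  - by move=> e; have := Gg i'; rewrite e irrG.
  - by move=> e; have := Gg j'; rewrite -e irrG.
move=> i j; rewrite /star.
by case: unliftP => [i'|] ->; case: unliftP => [j'|] -> //=; rewrite symG.
Qed.

(** At least [d.+1 * d] paths of length two leave [v] for at most [#|V| - 1] other vertices, so by
    pigeonhole two of them share their end and close a 4-cycle. *)
Lemma min_degree_C4 (V : finType) (H : rel V) (d : nat) (v : V) :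
    symmetric H -> irreflexive H -> #|V| <= d.+1 * d ->
    (forall w, d < #|[set x | H w x]|) ->
  contains_copy C4 H.
Proof.
move=> symH irrH small deg.
pose paths x := #|[set w | H v w & H w x]|.
have many : d.+1 * d <= \sum_(x | x != v) paths x.
  (* Double counting: the paths are grouped by midpoint instead of by end. *)
  have -> : \sum_(x | x != v) paths x =
            \sum_(w in [set w | H v w]) #|[set x | H w x] :\ v|.
    rewrite (eq_bigr (fun x => \sum_(w | H v w && H w x) 1)); last first.
      by move=> x _; rewrite sum1dep_card /paths.
    rewrite (exchange_big_dep (H v)) /=; last by move=> x w _ /andP[].
    rewrite [RHS](eq_bigl (H v)) => [|w]; last by rewrite inE.
    apply: eq_bigr => w Hvw; rewrite -sum1_card; apply: eq_bigl => x.
    by rewrite !inE Hvw.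
  apply: (@leq_trans (\sum_(w in [set w | H v w]) d)).
    by rewrite sum_nat_const leq_mul2r deg orbT.
  apply: leq_sum => w; rewrite inE => Hvw.
  by have := deg w; rewrite (cardsD1 v) inE symH Hvw.
have [/existsP[x /andP[xv /card_gt1P[w [w' [+ + ww']]]]]|] :=
    boolP [exists x, (x != v) && (1 < paths x)].
  rewrite !inE => /andP[vw wx] /andP[vw' w'x].
  by apply: (@contains_C4 _ _ v w x w'); rewrite // 1?eq_sym // symH.
rewrite negb_exists => /forallP few.
have : \sum_(x | x != v) paths x <= \sum_(x | x != v) 1.
  by apply: leq_sum => x xv; have := few x; rewrite xv /= -leqNgt.
have : \sum_(x | x != v) 1 < #|V|.
  by rewrite -sum1_card [X in _ < X](bigD1 v).
by move=> lt1 le1; exfalso; lia.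
Qed.

Lemma Kmulti_compl_sym (c s : nat) (H : rel ('I_c * 'I_s)) :
  symmetric H -> symmetric (rel_compl (@Kmulti c s) H).
Proof. by move=> symH u v; rewrite /rel_compl /Kmulti symH eq_sym. Qed.

Lemma Kmulti_compl_irr (c s : nat) (H : rel ('I_c * 'I_s)) :
  irreflexive (rel_compl (@Kmulti c s) H).
Proof. by move=> u; rewrite /rel_compl /Kmulti eqxx. Qed.

Lemma Kmulti_degree (c s : nat) (v : 'I_c * 'I_s) :
  #|[set w | Kmulti v w]| = c.-1 * s.
Proof.
have -> : [set w | Kmulti v w] = setX [set~ v.1] [set: 'I_s].
  by apply/setP=> w; rewrite !inE andbT eq_sym.
by rewrite cardsX cardsC1 cardsT !card_ord.
Qed.

Lemma Kmulti_arrows (c s q : nat) :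
    0 < c -> 0 < s -> 2 <= q -> c.-1 * s = q ^ 2 - 1 -> s <= q ->
  arrows_C4_star c s (q ^ 2 - q - 1).
Proof.
move=> c_gt0 s_gt0 q_ge2 cs sq H [symH subH].
have irrH : irreflexive H.
  by move=> u; apply/negP => /subH; rewrite /Kmulti eqxx.
pose G := rel_compl (@Kmulti c s) H.
have [/existsP big|] :=
    boolP [exists v, q ^ 2 - q - 1 <= #|[set w | G v w]|].
  right; apply/contains_starP => //; first exact: Kmulti_compl_sym.
  exact: Kmulti_compl_irr.
rewrite negb_exists => /forallP small; left.
apply: (@min_degree_C4 _ H q (Ordinal c_gt0, Ordinal s_gt0)) => //.
  (* The vertices number [q ^ 2 - 1 + s], below [q.+1 * q] because [s <= q]. *)
  by rewrite card_prod !card_ord; nia.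
(* Of the [q ^ 2 - 1] vertices in other classes, at most [q ^ 2 - q - 2] are non-neighbours, which
   leaves [q + 1] neighbours. *)
move=> v; have := small v; rewrite -ltnNge.
have := Kmulti_degree c s v; rewrite -(cardsID [set w | H v w]) cs.
have -> : [set w | Kmulti v w] :&: [set w | H v w] = [set w | H v w].
  by apply/setIidPr/subsetP => w; rewrite !inE => /subH.
have -> : [set w | Kmulti v w] :\: [set w | H v w] = [set w | G v w].
  by apply/setP => w; rewrite !inE /G /rel_compl andbC.
nia.
Qed.

Section Plane.

Import GRing.Theory.
Local Open Scope ring_scope.

Variable F : finFieldType.
Implicit Types u v w : F * F.

Definition det2 u v : F := u.1 * v.2 - u.2 * v.1.

(** This excludes 4-cycles: opposite vertices of one would have two common neighbours. *)
Lemma det2_codegree u v w w' : u != v ->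
  det2 u w = 1 -> det2 v w = 1 -> det2 u w' = 1 -> det2 v w' = 1 -> w = w'.
Proof.
case: u v w w' => [a b] [c d] [x y] [z t]; rewrite /det2 /= => uv e1 e2 e3 e4.
(* Cramer's rule: both [w] and [w'] solve the same linear system. *)
have solve (x' y' : F) : a * y' - b * x' = 1 -> c * y' - d * x' = 1 ->
    (a * d - b * c) * x' = c - a /\ (a * d - b * c) * y' = d - b.
  move=> e e'; split.
    transitivity (c * (a * y' - b * x') - a * (c * y' - d * x')); first by ring.
    by rewrite e e' !mulr1.
  transitivity (d * (a * y' - b * x') - b * (c * y' - d * x')); first by ring.
  by rewrite e e' !mulr1.
have [[Dx Dy] [Dz Dt]] := (solve _ _ e1 e2, solve _ _ e3 e4).
(* A singular system would force [c = a] and [d = b], that is [u = v]. *)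
have [D0|D_neq0] := eqVneq (a * d - b * c) 0.
  case/eqP: uv; move: Dx Dy; rewrite D0 !mul0r.
  by move=> /esym/subr0_eq-> /esym/subr0_eq->.
by congr (_, _); apply: (mulfI D_neq0); rewrite ?Dx ?Dy.
Qed.

(** One solution [w] exists since [u] is nonzero, and adding multiples of [u] to it preserves the
    determinant. *)
Lemma det2_degree u : u != 0 -> (#|F| <= #|[set w | (det2 u w == 1)%R]|)%N.
Proof.
move=> u0.
have [w uw] : exists w, det2 u w = 1.
  case: u u0 => a b; rewrite /det2 /= xpair_eqE negb_and.
  have [-> /= b0|a0 _] := eqVneq a 0.
    by exists (- b^-1, 0); rewrite /= mulr0 mulrN opprK add0r divff.
  by exists (0, a^-1); rewrite /= mulr0 subr0 divff.
pose g t : F * F := (w.1 + t * u.1, w.2 + t * u.2).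
have g_inj : injective g.
  move=> t t' [/addrI e1 /addrI e2]; apply/eqP; rewrite -subr_eq0.
  apply: contraR u0 => tt'; apply/eqP.
  rewrite [u]surjective_pairing; congr (_, _); apply: (mulfI tt').
    by rewrite mulr0 mulrBl e1 subrr.
  by rewrite mulr0 mulrBl e2 subrr.
rewrite -cardsT -(card_imset _ g_inj) subset_leq_card //.
apply/subsetP=> _ /imsetP[t _ ->]; rewrite inE -uw /det2 /=.
by apply/eqP; ring.
Qed.

(** The zero vector, [u], the counted set and the neighbours of [u] are pairwise disjoint in the
    plane, as [det2 u 0] and [det2 u u] vanish. *)
Lemma det2_nondegree u : u != 0 ->
  (#|[set w : F * F | [&& w != 0, w != u & det2 u w != 1]%R]|
   <= #|F| ^ 2 - #|F| - 2)%N.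
Proof.
move=> u0; set A := [set w | _].
have A0 : 0 \notin u |: A by rewrite !inE eqxx eq_sym orbF.
have Au : u \notin A by rewrite !inE eqxx andbF.
have disj : [disjoint (0 : F * F) |: (u |: A) & [set w | det2 u w == 1]].
  apply/pred0P => w /=; rewrite !inE; apply/negP => /andP[+ /eqP uw].
  have z : (0 : F) == 1 = false by rewrite eq_sym oner_eq0.
  move=> /or3P[/eqP e|/eqP e|].
  - by move/eqP: uw; rewrite e /det2 /= !mulr0 subrr z.
  - by move/eqP: uw; rewrite e /det2 mulrC subrr z.
  - by rewrite uw eqxx !andbF.
have := max_card [in ((0 : F * F) |: (u |: A)) :|: [set w | det2 u w == 1]].
rewrite card_prod cardsU (disjoint_setI0 disj) cards0 subn0.
rewrite !cardsU1 A0 Au -mulnn.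
have := det2_degree _ u0.
by move: #|_| #|A| #|F| => a b q /=; lia.
Qed.

Lemma det2_sym u v : 2%N \in [pchar F] -> det2 u v = det2 v u.
Proof.
move=> char2; rewrite /det2 !(oppr_pchar2 char2) addrC.
by rewrite mulrC [u.1 * _]mulrC.
Qed.

Lemma Kmulti_not_arrows (c s : nat) : 2%N \in [pchar F] ->
  (c * s <= #|F| ^ 2 - 1)%N -> ~ arrows_C4_star c s (#|F| ^ 2 - #|F| - 1).
Proof.
move=> char2 cs.
pose P := [set~ 0 : F * F].
have le_cs : (#|{: 'I_c * 'I_s}| <= #|P|)%N.
  by rewrite cardsC1 !card_prod !card_ord -subn1 mulnn.
(* Any injection into the nonzero vectors will do: the classes need no geometric meaning. *)
pose g (x : 'I_c * 'I_s) : F * F := enum_val (widen_ord le_cs (enum_rank x)).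
have g_inj : injective g.
  by move=> x y /enum_val_inj/(congr1 val) /= /val_inj/enum_rank_inj.
have g0 x : g x != 0.
  by have := enum_valP (widen_ord le_cs (enum_rank x)); rewrite !inE.
pose H : rel ('I_c * 'I_s) :=
  fun x y => (x.1 != y.1) && (det2 (g x) (g y) == 1).
have symH : symmetric H by move=> x y; rewrite /H eq_sym det2_sym.
case/(_ H); first by split=> // x y /andP[].
  case/C4_copy_vertices=> x [y [z [t [xz yt]]]].
  case/and4P=> /andP[_ /eqP xy] /andP[_ /eqP yz] /andP[_ /eqP zt].
  case/andP=> _ /eqP tx; case/eqP: yt; apply: (g_inj).
  apply: (@det2_codegree (g x) (g z)) => //; last by rewrite det2_sym.
    by rewrite (inj_eq g_inj).
  by rewrite det2_sym.
case/contains_starP => [||x]; first exact: Kmulti_compl_sym.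
  exact: Kmulti_compl_irr.
apply/negP; rewrite -ltnNge.
have le_deg : (#|[set w | rel_compl (@Kmulti c s) H x w]|
               <= #|F| ^ 2 - #|F| - 2)%N.
  apply: leq_trans (det2_nondegree _ (g0 x)).
  rewrite -(card_imset _ g_inj) subset_leq_card //.
  apply/subsetP=> _ /imsetP[w + ->]; rewrite !inE /rel_compl /Kmulti /H.
  case/andP=> xw; rewrite xw /= => ->; rewrite g0 (inj_eq g_inj) andbT /=.
  by apply: contraNneq xw => ->.
apply: leq_ltn_trans le_deg _.
(* With [q >= 2] the number [q ^ 2 - q - 1] is positive, so the truncated subtraction of one more is
   strictly smaller. *)
have := finNzRing_gt1 F; move: #|_| => q q_gt1.
by have := leq_mul q_gt1 (leqnn q); rewrite mulnn; lia.
Qed.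

End Plane.

Theorem theoremB (s m : nat) (hs : 3 <= s) (hodd : odd s) (hm : 0 < m)
  (hmod : 4 ^ m = 1 %[mod s]) (hge : s <= 2 ^ m) (k : nat) (hk : 0 < k) :
  is_M s (2 ^ (2 * m * k) - 2 ^ (m * k) - 1) ((2 ^ (2 * m * k) - 1) %/ s + 1).
Proof.
have q2 : 2 ^ (2 * m * k) = (2 ^ (m * k)) ^ 2 by rewrite -expnM -mulnA mulnC.
have s_dvd : s %| 2 ^ (2 * m * k) - 1.
  (* The power is [(4 ^ m) ^ k], congruent to 1 modulo [s]. *)
  rewrite -eqn_mod_dvd ?expn_gt0 // -mulnA expnM (expnM (2 ^ 2)).
  by rewrite -modnXm hmod modnXm exp1n.
have s_le : s <= 2 ^ (m * k).
  by apply: leq_trans hge _; rewrite leq_exp2l // leq_pmulr.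
rewrite q2 in s_dvd *; set q := 2 ^ (m * k) in s_dvd s_le *.
split; first by rewrite addn1.
  by apply: Kmulti_arrows; rewrite ?addn1 //= ?divnK //; lia.
have mk_gt0 : 0 < m * k by rewrite muln_gt0 hm.
have [F char2 cardF] := PrimePowerField (isT : prime 2) mk_gt0.
(* A smaller [c'] satisfies [c' * s <= q ^ 2 - 1], so its vertices fit among the nonzero vectors. *)
move=> c' _ arr; rewrite addn1 ltnNge; apply/negP => le_c'.
have := @Kmulti_not_arrows F c' s char2; rewrite cardF -/q; apply=> //.
by rewrite -leq_divRL //; lia.
Qed.
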